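(* Let $k\ge s\ge 1$ be integers and let $\tau_1,\dots,\tau_k\in[0,1]$ be distinct abscissae, with interpolatory quadrature weights $\omega_i=\int_0^1\ell_i(t)\,\mathrm{d}t$, $i=1,\dots,k$, where $\ell_i$ is the $i$-th Lagrange polynomial of degree $k-1$ on the nodes $\{\tau_i\}$. Assume that the quadrature formula $(\omega_i,\tau_i)_{i=1}^k$ has order at least $2s$, i.e. it is exact for all polynomials of degree at most $2s-1$. Then the method HBVM$(k,s)$ (defined in the context) has order $p=2s$, whatever the choice of the $s$ fundamental abscissae $c_1,\dots,c_s$ among the $\{\tau_i\}$.
   Context: Let $\hat P_{i-1}$ denote the shifted Legendre polynomial of degree $i-1$ on $[0,1]$ and $P_i(t)=\sqrt{2i-1}\,\hat P_{i-1}(t)$, so that $\int_0^1P_i(t)P_j(t)\,\mathrm{d}t=\delta_{ij}$ and $\deg P_i=i-1$. For the initial value problem $\dot y=f(y)$, $y(t_0)=y_0\in\mathbb R^{2m}$ (in the Hamiltonian setting $f(y)=J\nabla H(y)$ with $J$ a constant skew-symmetric matrix), the method HBVM$(k,s)$ with stepsize $h$ is the Runge--Kutta method with abscissae $\tau_1,\dots,\tau_k$, weights $\omega_1,\dots,\omega_k$ and Butcher matrix $A=\mathcal I_s\mathcal P_s^T\Omega\in\mathbb R^{k\times k}$, where $\Omega=\mathrm{diag}(\omega_1,\dots,\omega_k)$ and $\mathcal I_s,\mathcal P_s\in\mathbb R^{k\times s}$ have entries $(\mathcal I_s)_{ij}=\int_0^{\tau_i}P_j(x)\,\mathrm{d}x$,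 $(\mathcal P_s)_{ij}=P_j(\tau_i)$. Explicitly, the stages satisfy $y_i=y_0+h\sum_{j=1}^s\int_0^{\tau_i}P_j(x)\,\mathrm{d}x\sum_{\ell=1}^k\omega_\ell P_j(\tau_\ell)f(y_\ell)$, $i=1,\dots,k$, and $y_1^{\rm new}=y_0+h\sum_{i=1}^k\omega_if(y_i)$. The abscissae $\{\tau_i\}$ are split into $s$ ''fundamental'' abscissae $c_1,\dots,c_s$ and $k-s$ ''silent'' ones; the tableau does not depend on this split. Order $p$ means the local error is $O(h^{p+1})$ for smooth $f$. *)

(* Defs.v *)
From HB Require Import structures.
From mathcomp Require Import all_boot all_order all_algebra.
From mathcomp Require Import all_classical all_reals all_analysis.
Set Implicit Arguments. Unset Strict Implicit. Unset Printing Implicit Defensive.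
Import Order.TTheory GRing.Theory Num.Theory.
Import numFieldNormedType.Exports.
Local Open Scope classical_set_scope.
Local Open Scope ring_scope.

Section HBVM.
Variable R : realType.

Definition Rint (a b : R) (g : R -> R) : R :=
  Rintegral (@lebesgue_measure R) `[a, b] g.

Definition shLeg (n : nat) : {poly R} :=
  \poly_(q < n.+1) ((-1) ^+ (n + q) * ('C(n, q) * 'C(n + q, q))%:R).

(* Normalized Legendre basis, 0-indexed: legP j = P_{j+1} = sqrt(2j+1) hatP_j,
   so that legP j has degree j and int_0^1 legP i legP j = delta_ij. *)
Definition legP (j : nat) : {poly R} := Num.sqrt (j.*2.+1)%:R *: shLeg j.

Definition lagrange (k : nat) (tau : 'I_k -> R) (i : 'I_k) : {poly R} :=
  \prod_(j < k | j != i) ((tau i - tau j)^-1 *: ('X - (tau j)%:P)).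

Definition qweight (k : nat) (tau : 'I_k -> R) (i : 'I_k) : R :=
  Rint 0 1 (fun t => (lagrange tau i).[t]).

Definition quad_exact_upto (k : nat) (tau : 'I_k -> R) (d : nat) : Prop :=
  forall p : {poly R}, (size p <= d)%N ->
    \sum_(i < k) qweight tau i * p.[tau i] = Rint 0 1 (fun t => p.[t]).

Definition Imat (k s : nat) (tau : 'I_k -> R) : 'M[R]_(k, s) :=
  \matrix_(i < k, j < s) Rint 0 (tau i) (fun x => (legP j).[x]).
Definition Pmat (k s : nat) (tau : 'I_k -> R) : 'M[R]_(k, s) :=
  \matrix_(i < k, j < s) (legP j).[tau i].
Definition Omega (k : nat) (tau : 'I_k -> R) : 'M[R]_k :=
  diag_mx (\row_(i < k) qweight tau i).

Definition hbvmA (k s : nat) (tau : 'I_k -> R) : 'M[R]_k :=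
  Imat s tau *m (Pmat s tau)^T *m Omega tau.
Definition hbvmb (k : nat) (tau : 'I_k -> R) : 'I_k -> R := qweight tau.

Fixpoint iderive (n : nat) (vs : seq 'rV[R]_n) (g : 'rV[R]_n -> 'rV[R]_n)
  : 'rV[R]_n -> 'rV[R]_n :=
  match vs with
  | [::] => g
  | v :: vs' => fun x => derive (iderive vs' g) x v
  end.

Definition smooth (n : nat) (g : 'rV[R]_n -> 'rV[R]_n) : Prop :=
  forall vs : seq 'rV[R]_n,
    continuous (iderive vs g) /\ (forall x v, derivable (iderive vs g) x v).

Definition rk_stages (k n : nat) (A : 'M[R]_k) (h : R)
  (f : 'rV[R]_n -> 'rV[R]_n) (y0 : 'rV[R]_n) (Y : 'I_k -> 'rV[R]_n) : Prop :=
  forall i : 'I_k, Y i = y0 + h *: \sum_(j < k) A i j *: f (Y j).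

Definition rk_step (k n : nat) (b : 'I_k -> R) (h : R)
  (f : 'rV[R]_n -> 'rV[R]_n) (y0 : 'rV[R]_n) (Y : 'I_k -> 'rV[R]_n) : 'rV[R]_n :=
  y0 + h *: \sum_(i < k) b i *: f (Y i).

(* Order (at least) p of the RK method (A,b): for every smooth f on R^{2m},
   every initial datum and every exact solution, the (locally unique, near y0)
   stage solution exists for small h > 0 and the local error is O(h^{p+1}). *)
Definition rk_has_order (k : nat) (A : 'M[R]_k) (b : 'I_k -> R) (p : nat) : Prop :=
  forall (m : nat) (f : 'rV[R]_(m.*2) -> 'rV[R]_(m.*2)), smooth f ->
  forall (t0 : R) (y0 : 'rV[R]_(m.*2)) (a : R) (y : R -> 'rV[R]_(m.*2)),
    0 < a -> y t0 = y0 ->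
    (forall t, t0 - a < t < t0 + a -> is_derive t 1 y (f (y t))) ->
    exists delta C h0 : R, [/\ 0 < delta, 0 < h0, h0 < a &
      forall h, 0 < h <= h0 ->
        (exists Y : 'I_k -> 'rV[R]_(m.*2),
            rk_stages A h f y0 Y /\ forall i, `|Y i - y0| <= delta) /\
        (forall Y : 'I_k -> 'rV[R]_(m.*2),
            rk_stages A h f y0 Y -> (forall i, `|Y i - y0| <= delta) ->
            `|rk_step b h f y0 Y - y (t0 + h)| <= C * h ^+ p.+1)].

End HBVM.

(* Main.v *)
(* Let [E_i] be the difference between the i-th stage and the exact solution at
   [t0 + tau_i h].  The polynomials [legP] are orthonormal and the quadrature is
   exact up to degree [2s - 1], so the tableau satisfies Butcher's simplifying
   assumptions B(2s), C(s) and D(s-1); hence [E_i = O(h^(s+1))].  Linearizing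
   [f] along the exact solution costs only [O(h^(2s+2))].  The order is doubled
   by looking at the moments [sum_i w_i g(tau_i) E_i], for [g] of degree [q]:
   D(s-1) moves one application of the matrix [A] onto [g], which raises the
   degree by one and gains a factor [h], so that a descending induction on [q]
   shows that these moments are [O(h^(2s - q))].  The local error is [h] times
   a combination of such moments, up to the quadrature error [O(h^(2s+1))]. *)

Require Import Defs.
From HB Require Import structures.
From mathcomp Require Import all_boot all_order all_algebra.
From mathcomp Require Import all_classical all_reals all_analysis.
From mathcomp Require Import ring lra zify.
Import Order.TTheory GRing.Theory Num.Theory.
Import numFieldNormedType.Exports.
Local Open Scope ring_scope.

Set Implicit Arguments.
Unset Strict Implicit.
Unset Printing Implicit Defensive.

(** * Integrals of polynomials, Legendre polynomials, simplifying assumptions *)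

Section PolynomialIntegral.
Variable R : realType.
Implicit Types p q g : {poly R}.

(** The antiderivative vanishing at 0, kept purely algebraic: analysis enters the polynomial part
    only through [Rint_horner]. *)
Definition prim p : {poly R} := \poly_(i < (size p).+1) (p`_i.-1 / i%:R).

(* At [i = 0] the quotient is the junk value [p`_0 / 0 = 0]. *)
Lemma coef_prim p i : (prim p)`_i = p`_i.-1 / i%:R.
Proof.
rewrite coef_poly; case: ltnP => // hi.
rewrite nth_default ?mul0r //; by case: i hi.
Qed.

Lemma size_prim p : (size (prim p) <= (size p).+1)%N.
Proof. exact: size_poly. Qed.

Lemma deriv_prim p : (prim p)^`() = p.
Proof.
by apply/polyP => i; rewrite coef_deriv coef_prim -[LHS]mulr_natr divfK.
Qed.

Lemma prim_horner0 p : (prim p).[0] = 0.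
Proof. by rewrite horner_coef0 coef_prim invr0 mulr0. Qed.

Lemma prim_is_linear : linear prim.
Proof.
move=> a p q; apply/polyP => i.
by rewrite coefD coefZ !coef_prim coefD coefZ mulrDl mulrA.
Qed.
HB.instance Definition _ :=
  GRing.isLinear.Build R {poly R} {poly R} _ prim prim_is_linear.

Lemma prim_deriv p : prim p^`() = p - (p.[0])%:P.
Proof.
apply/polyP => -[|i]; rewrite coef_prim coefB coefC horner_coef0 /=.
  by rewrite invr0 mulr0 subrr.
by rewrite coef_deriv subr0 -[_ *+ _]mulr_natr mulfK // pnatr_eq0.
Qed.

Lemma primXn n : prim 'X^n = (n.+1%:R)^-1 *: 'X^(n.+1).
Proof.
apply/polyP => -[|i]; rewrite coef_prim coefZ !coefXn /=.
  by rewrite invr0 !mulr0.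
rewrite eqSS; case: eqP => [->|_]; by rewrite ?mul1r ?mulr1 ?mul0r ?mulr0.
Qed.

(** Separates the powers of a stepsize [x] from the abscissa [c], leaving the numbers [(prim
    'X^i).[c]] that occur in the order conditions. *)
Lemma horner_prim_scale p c x :
  (prim p).[c * x] = \sum_(i < size p) p`_i * (prim 'X^i).[c] * x ^+ i.+1.
Proof.
rewrite -{1}[p]coefK poly_def raddf_sum horner_sum /=; apply: eq_bigr => i _.
by rewrite linearZ /= hornerZ !primXn !hornerZ !hornerXn exprMn !mulrA.
Qed.

Definition pint p : R := (prim p).[1].

Lemma pint_is_linear : scalar pint.
Proof. by move=> a p q; rewrite /pint linearP hornerD hornerZ. Qed.
HB.instance Definition _ :=
  GRing.isLinear.Build R {poly R} R _ pint pint_is_linear.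

Lemma pintZ a p : pint (a *: p) = a * pint p.
Proof. exact: linearZ. Qed.

Lemma pint_deriv p : pint p^`() = p.[1] - p.[0].
Proof. by rewrite /pint prim_deriv !hornerE. Qed.

Lemma pint_parts p q :
  pint (p^`() * q) = p.[1] * q.[1] - p.[0] * q.[0] - pint (p * q^`()).
Proof.
apply/eqP; rewrite eq_sym subr_eq eq_sym -raddfD /= -derivM pint_deriv.
by rewrite !hornerM.
Qed.

(** Integration by parts. The polynomial [pint g - prim g] is the antiderivative of [- g] vanishing
    at 1; this is the continuous counterpart of condition D. *)
Lemma pint_prim g q : pint (g * prim q) = pint (((pint g)%:P - prim g) * q).
Proof.
rewrite -[X in pint (X * _)]deriv_prim pint_parts deriv_prim !prim_horner0.
rewrite mul0r subr0 mulrBl raddfB /=; congr (_ - _).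
by rewrite mul_polyC linearZ.
Qed.

Lemma Rint_horner p (a : R) : 0 <= a ->
  Defs.Rint 0 a (fun t => p.[t]) = (prim p).[a].
Proof.
rewrite le_eqVlt => /predU1P[<-|a0].
  by rewrite /Defs.Rint set_itv1 Rintegral_set1 prim_horner0.
rewrite /Defs.Rint /Rintegral (@continuous_FTC2 _ _ (horner (prim p))) //=.
- by rewrite prim_horner0 subr0.
- exact/continuous_subspaceT/continuous_horner.
- split.
  + by move=> x _; exact: derivable_horner.
  + exact/cvg_at_right_filter/continuous_horner.
  + exact/cvg_at_left_filter/continuous_horner.
- by move=> x _; rewrite -derivE deriv_prim.
Qed.

End PolynomialIntegral.

(** * Shifted Legendre polynomials: Rodrigues' formula, orthonormality, expansion *)

Section Legendre.
Variable R : realType.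
Implicit Types p q g : {poly R}.

(** Each differentiation uses up at most one factor [q]; this makes the boundary terms vanish in the
    repeated integration by parts. *)
Lemma deriv_exp_dvd (q : {poly R}) n j : (j <= n)%N ->
  exists r, (q ^+ n)^`(j) = q ^+ (n - j) * r.
Proof.
elim: j => [|j IH] hj; first by exists 1; rewrite derivn0 subn0 mulr1.
have [r hr] := IH (ltnW hj).
have e : (n - j = (n - j.+1).+1)%N by lia.
exists (q^`() * r *+ (n - j) + q * r^`()).
rewrite derivnS hr derivM deriv_exp {1 2}e /=.
rewrite [in RHS]mulrDr [_ ^+ _ * (q * _)]mulrA -exprSr -e.
congr (_ + _); rewrite mulrnAl mulrnAr !mulrA; congr (_ * _ *+ _).
by rewrite mulrC.
Qed.

Lemma pint_parts_iter n q p : q.[0] = 0 -> q.[1] = 0 ->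
  forall j, (j <= n)%N ->
  pint ((q ^+ n)^`(n) * p) = (-1) ^+ j * pint ((q ^+ n)^`(n - j) * p^`(j)).
Proof.
move=> q0 q1; elim=> [|j IH] hj; first by rewrite expr0 mul1r subn0 derivn0.
rewrite IH ?(ltnW hj) // exprSr -mulrA; congr (_ * _).
have -> : (n - j = (n - j.+1).+1)%N by lia.
rewrite derivnS pint_parts -derivnS mulN1r.
have [r ->] := @deriv_exp_dvd q n (n - j.+1) (leq_subr _ _).
have -> : (n - (n - j.+1) = j.+1)%N by lia.
by rewrite !(hornerM, horner_exp) q0 q1 !exprS !mul0r !subr0 sub0r.
Qed.

Lemma shLeg_Rodrigues n : shLeg R n = (('X^2 - 'X) ^+ n)^`N(n).
Proof.
have -> : 'X^2 - 'X = ('X - 1) * 'X :> {poly R} by rewrite mulrBl mul1r expr2.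
rewrite exprMn; apply/polyP => q.
rewrite coef_poly coef_nderivn coefMXn [(n + q < n)%N]ltnNge leq_addr addKn /=.
have -> : ('X - 1) ^+ n = (- 1%:P + 'X) ^+ n :> {poly R}.
  by rewrite addrC.
rewrite exprDn.
rewrite coef_sum ltnS; case: leqP => hq.
  rewrite (bigD1 (Ordinal (hq : (q < n.+1)%N))) //= big1 => [|i hi].
    rewrite addr0 coefMn -polyCN -rmorphXn /= coefCM coefXn eqxx mulr1.
    rewrite -!mulrnA -[RHS]mulr_natr; congr (_ * _).
      by rewrite -signr_odd -[RHS]signr_odd oddD oddB.
    congr (_ * _)%:R; rewrite -bin_sub ?leq_addl ?addnK //.
  rewrite coefMn -polyCN -rmorphXn /= coefCM coefXn.
  have -> : (q == i) = false by apply/negbTE; rewrite eq_sym.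
  by rewrite mulr0 mul0rn.
rewrite big1 ?mul0rn // => i _.
rewrite coefMn -polyCN -rmorphXn /= coefCM coefXn.
have -> : (q == i) = false by apply/negbTE; have := ltn_ord i; lia.
by rewrite mulr0 mul0rn.
Qed.

(** Rodrigues' formula and n integrations by parts. Both orthogonality to lower degrees and the
    value of the norm follow from this identity. *)
Lemma pint_shLeg n p :
  pint (shLeg R n * p) =
    (-1) ^+ n * pint (('X^2 - 'X) ^+ n * p^`(n)) / n`!%:R.
Proof.
have h : shLeg R n = n`!%:R^-1 *: (('X^2 - 'X) ^+ n)^`(n).
  rewrite nderivn_def -shLeg_Rodrigues -[X in _ *: X]scaler_nat.
  rewrite scalerA mulVf ?scale1r // pnatr_eq0 -lt0n fact_gt0 //.
rewrite h -scalerAl linearZ /= mulrC; congr (_ / _).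
rewrite (@pint_parts_iter n _ p _ _ n) ?subnn ?derivn0 //.
  by rewrite !hornerE; ring.
by rewrite !hornerE; ring.
Qed.

(** Euler's Beta integral at integers: each integration by parts trades one power of 1 - X for one
    power of X. *)
Lemma pint_beta a b :
  pint ('X^a * (1 - 'X) ^+ b) = (a`! * b`!)%:R / ((a + b).+1)`!%:R :> R.
Proof.
elim: b a => [|b IH] a.
  rewrite expr0 mulr1 /pint primXn hornerZ hornerXn expr1n mulr1 addn0 fact0.
  rewrite muln1 factS natrM; field.
  by rewrite nat1r !pnatr_eq0 -!lt0n fact_gt0.
have h : 'X^a = (prim 'X^a)^`() :> {poly R} by rewrite deriv_prim.
rewrite h pint_parts prim_horner0 primXn.
have -> : ((1 - 'X) ^+ b.+1).[1] = 0 :> R.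
  by rewrite horner_exp !hornerE subrr expr0n.
rewrite mulr0 mul0r subr0 sub0r.
rewrite deriv_exp derivB derivC derivX /=.
have -> : a.+1%:R^-1 *: 'X^(a.+1) * ((0 - 1) * (1 - 'X) ^+ b *+ b.+1) =
    (- (b.+1%:R / a.+1%:R)) *: ('X^(a.+1) * (1 - 'X) ^+ b) :> {poly R}.
  rewrite sub0r mulN1r -[X in _ * X]scaler_nat -scalerAl -scalerAr mulrN.
  by rewrite !scalerN scalerA scaleNr [_ / _]mulrC.
rewrite linearZ /= mulNr opprK IH.
have -> : (a.+1 + b = a + b.+1)%N by rewrite addSnnS.
rewrite !factS !natrM; field.
by rewrite !nat1r -natrD nat1r !pnatr_eq0 -!lt0n fact_gt0.
Qed.

Lemma size_shLeg n : (size (shLeg R n) <= n.+1)%N.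
Proof. exact: size_poly. Qed.

Lemma pint_shLeg_low n p : (size p <= n)%N -> pint (shLeg R n * p) = 0.
Proof.
by move=> hp; rewrite pint_shLeg derivn_poly0 // mulr0 raddf0 mulr0 mul0r.
Qed.

Lemma shLeg_lead n : (shLeg R n)`_n = 'C(n.*2, n)%:R.
Proof.
by rewrite coef_poly ltnSn addnn -signr_odd odd_double expr0 mul1r binn mul1n.
Qed.

(** The n-th derivative of [shLeg R n] is the constant n! C(2n, n), so the norm reduces to the Beta
    integral n!^2 / (2n+1)!. *)
Lemma pint_shLeg_sqr n : pint (shLeg R n * shLeg R n) = (n.*2.+1)%:R^-1.
Proof.
rewrite pint_shLeg.
have -> : (shLeg R n)^`(n) = (n`!%:R * 'C(n.*2, n)%:R)%:P.
  have hs : (size (shLeg R n)^`(n) <= 1)%N.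
    apply/leq_sizeP => i hi; rewrite coef_derivn nth_default ?mul0rn //.
    by rewrite (leq_trans (size_shLeg n)) // -addn1 leq_add2l.
  rewrite [LHS]size1_polyC //; congr (_ %:P).
  by rewrite coef_derivn addn0 ffactnn shLeg_lead mulr_natl.
have -> : ('X^2 - 'X) ^+ n = (-1) ^+ n *: ('X^n * (1 - 'X) ^+ n) :> {poly R}.
  rewrite -exprMn -[in RHS]scaleN1r /= -exprZn scaleN1r; congr (_ ^+ _).
  by rewrite scaleN1r mulrBr mulr1 opprB expr2.
rewrite mulrC [_ * _%:P]mulrC mul_polyC scalerA pintZ pint_beta.
rewrite -[_ * (-1) ^+ n]mulrC !mulrA.
have h0 : (-1) ^+ n * (-1) ^+ n = 1 :> R.
  by rewrite -exprD addnn -signr_odd odd_double.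
have hb := @bin_fact n.*2 n; rewrite -addnn leq_addr addnK in hb.
have {}hb := hb isT.
rewrite addnn in hb *; rewrite factS -hb !natrM.
have h1 : n`!%:R != 0 :> R by rewrite pnatr_eq0 -lt0n fact_gt0.
have h2 : 'C(n.*2, n)%:R != 0 :> R by rewrite pnatr_eq0 -lt0n bin_gt0; lia.
rewrite -[_ * _ * (-1) ^+ n]mulrA h0 mulr1; field.
by rewrite h1 h2 nat1r pnatr_eq0.
Qed.

Lemma size_legP j : (size (legP R j) <= j.+1)%N.
Proof. exact: leq_trans (size_scale_leq _ _) (size_shLeg j). Qed.

Lemma pint_legP_low n p : (size p <= n)%N -> pint (legP R n * p) = 0.
Proof.
by move=> hp; rewrite /legP -scalerAl linearZ /= pint_shLeg_low ?mulr0.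
Qed.

Lemma pint_legP_sqr n : pint (legP R n * legP R n) = 1.
Proof.
rewrite /legP -scalerAl -scalerAr scalerA linearZ /= pint_shLeg_sqr.
by rewrite -expr2 sqr_sqrtr ?ler0n // divff ?pnatr_eq0.
Qed.

Lemma legP_lead_neq0 n : (legP R n)`_n != 0.
Proof.
rewrite coefZ shLeg_lead mulf_neq0 ?pnatr_eq0 -?lt0n ?bin_gt0; try lia.
by rewrite gt_eqF // sqrtr_gt0 ltr0n.
Qed.

(** Subtracting the multiple of the last basis element that cancels the top coefficient lowers the
    size; orthogonality identifies the coefficients. *)
Lemma legP_expansion s p : (size p <= s)%N ->
  p = \sum_(j < s) pint (legP R j * p) *: legP R j.
Proof.
(* From here on the basis is an abstract family known by its orthogonality, unit norm, nonzero
   leading coefficients and degree bound. *)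
move: (legP R) pint_legP_low pint_legP_sqr legP_lead_neq0 size_legP.
move=> L L_low L_sqr L_lead size_L; elim: s p => [|s IH] p hp.
  by rewrite big_ord0; apply/eqP; rewrite -size_poly_eq0 -leqn0.
pose c := p`_s / (L s)`_s; pose q := p - c *: L s.
have hq : (size q <= s)%N.
  apply/leq_sizeP => i; rewrite leq_eqVlt => /predU1P[<-|hi].
    by rewrite coefB coefZ divfK ?subrr // L_lead.
  rewrite coefB coefZ !nth_default ?mulr0 ?subrr //.
    exact: leq_trans (size_L _) _.
  exact: leq_trans hp _.
have hpq : p = q + c *: L s by rewrite subrK.
clearbody q.
rewrite big_ord_recr /= hpq; congr (_ + _).
  rewrite {1}[q]IH //; apply: eq_bigr => j _; congr (_ *: _).
  rewrite mulrDr raddfD /= -scalerAr linearZ /= [L j * L s]mulrC.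
  by rewrite (L_low s) ?mulr0 ?addr0 // (leq_trans (size_L _)).
congr (_ *: _); rewrite mulrDr raddfD /= L_low // add0r.
by rewrite -scalerAr linearZ /= L_sqr mulr1.
Qed.

End Legendre.

(** * Butcher's conditions B(2s), C(s) and D(s-1) for the tableau *)

Section SimplifyingAssumptions.
Variables (R : realType) (k s : nat) (tau : 'I_k -> R).
Hypothesis s_gt0 : (0 < s)%N.
Hypothesis tau01 : forall i, 0 <= tau i <= 1.
Hypothesis exact : quad_exact_upto tau s.*2.
Implicit Types p q g : {poly R}.
Let w := qweight tau.
Let A := hbvmA s tau.

Lemma quad_pint p : (size p <= s.*2)%N ->
  \sum_(i < k) w i * p.[tau i] = pint p.
Proof. by move=> hp; rewrite exact // Rint_horner. Qed.

Lemma hbvmAE i l : A i l =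
  \sum_(j < s) (prim (legP R j)).[tau i] * (legP R j).[tau l] * w l.
Proof.
rewrite /A /hbvmA /Omega mul_mx_diag !mxE big_distrl /=.
apply: eq_bigr => j _; rewrite !mxE Rint_horner //.
by case/andP: (tau01 i).
Qed.

(** Condition C(s). The products of [p] with basis elements have degree at most 2s-2, so the
    quadrature returns the exact Legendre coefficients of [p], and [prim] is applied to its
    expansion. *)
Lemma hbvmA_C p i : (size p <= s)%N ->
  \sum_(l < k) A i l * p.[tau l] = (prim p).[tau i].
Proof.
move=> hp; under eq_bigr do rewrite hbvmAE mulr_suml.
move: (legP R) (legP_expansion hp) (@size_legP R) => L hL size_L.
rewrite [in RHS]hL raddf_sum horner_sum /=.
rewrite exchange_big /=; apply: eq_bigr => j _.
rewrite linearZ hornerZ /= -quad_pint; last first.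
  rewrite (leq_trans (size_polyMleq _ _)) // -addnn.
  by have := size_L j; have := ltn_ord j; lia.
rewrite mulr_suml; apply: eq_bigr => l _; rewrite hornerM; ring.
Qed.

(** Condition D(s-1). Here [g * prim (legP R j)] has degree at most 2s-2, so its quadrature is
    exact; by [pint_prim] it is the j-th Legendre coefficient of [G], whose degree is at most
    s-1. *)
Lemma hbvmA_D g l : (size g <= s.-1)%N ->
  \sum_(i < k) w i * g.[tau i] * A i l =
    w l * ((pint g)%:P - prim g).[tau l].
Proof.
move=> hg; set G := _ - _.
have hG : (size G <= s)%N.
  apply/leq_sizeP => i hi; rewrite coefB coefC coef_prim.
  have -> : (i == 0%N) = false by apply/negbTE; lia.
  by rewrite nth_default ?mul0r ?subrr // (leq_trans hg) //; lia.
under eq_bigr do rewrite hbvmAE mulr_sumr.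
move: (legP R) (legP_expansion hG) (@size_legP R) => L hL size_L.
rewrite [in RHS]hL horner_sum mulr_sumr.
rewrite exchange_big /=; apply: eq_bigr => j _.
rewrite hornerZ [L j * G]mulrC -pint_prim -quad_pint; last first.
  rewrite (leq_trans (size_polyMleq _ _)) // -addnn.
  by have := size_L j; have := size_prim (L j); have := ltn_ord j; lia.
rewrite mulr_suml mulr_sumr; apply: eq_bigr => i _; rewrite hornerM; ring.
Qed.

(** Reaches powers [p] beyond the range of C(s): D moves [A] onto [g], and both terms become exact
    quadratures whose integrals agree by [pint_prim]. *)
Lemma hbvmA_defect g (p : nat) : (size g <= s.-1)%N -> (size g + p < s.*2)%N ->
  \sum_(i < k) w i * g.[tau i] *
    (\sum_(l < k) A i l * tau l ^+ p - (prim 'X^p).[tau i]) = 0.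
Proof.
move=> hg hp.
under eq_bigr do rewrite mulrBr mulr_sumr.
rewrite sumrB exchange_big /=.
under eq_bigr => l _.
  under eq_bigr do rewrite mulrA.
  rewrite -mulr_suml hbvmA_D // -mulrA -hornerXn -hornerM.
  over.
rewrite quad_pint.
  under [X in _ - X]eq_bigr do rewrite -mulrA -hornerM.
  rewrite quad_pint ?pint_prim ?subrr //.
  have := size_prim ('X^p : {poly R}); rewrite size_polyXn => h.
  by rewrite (leq_trans (size_polyMleq _ _)) //; lia.
rewrite (leq_trans (size_polyMleq _ _)) // size_polyXn.
have h : (size ((pint g)%:P - prim g)%R <= (size g).+1)%N.
  rewrite (leq_trans (size_polyD _ _)) // size_polyN geq_max size_prim.
  by rewrite (leq_trans (size_polyC_leq1 _)).
by lia.
Qed.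

End SimplifyingAssumptions.

(** * Asymptotic bounds and polynomial approximation *)

Section BigO.
Variables (R : realType) (T : Type) (h : T -> R) (D : T -> Prop).
Implicit Types (f g : T -> R) (N M : nat).

(* [g = O(h^N)] uniformly over the parameters [t] in [D] as [h t -> 0+]. *)
Definition bigO N g := exists C h0 : R, [/\ 0 <= C, 0 < h0 &
  forall t, D t -> 0 <= h t <= h0 -> `|g t| <= C * h t ^+ N].

Lemma bigO_le_norm N f g h1 : 0 < h1 ->
  (forall t, D t -> 0 <= h t <= h1 -> `|f t| <= `|g t|) -> bigO N g -> bigO N f.
Proof.
move=> h10 fg [C [h0 [C0 h00 H]]]; exists C, (Num.min h0 h1); split => //.
  by rewrite lt_min h00.
move=> t Dt /andP[ht0]; rewrite le_min => /andP[ht1 ht2].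
by apply: le_trans (fg t Dt _) (H t Dt _); rewrite ht0.
Qed.

Lemma bigO_eq N f g : f =1 g -> bigO N g -> bigO N f.
Proof. by move=> fg; apply: (@bigO_le_norm _ _ _ 1) => // t _ _; rewrite fg. Qed.

Lemma bigO_eqD N f g : (forall t, D t -> f t = g t) -> bigO N g -> bigO N f.
Proof. by move=> fg; apply: (@bigO_le_norm _ _ _ 1) => // t Dt _; rewrite fg. Qed.

Lemma bigO_norm N g : bigO N g -> bigO N (fun t => `|g t|).
Proof. by apply: (@bigO_le_norm _ _ _ 1) => // t _ _; rewrite normr_id. Qed.

Lemma bigO_cst0 N : bigO N (fun=> 0).
Proof. by exists 0, 1; split => // t _ _; rewrite normr0 mul0r. Qed.

Lemma bigO_cst c : bigO 0 (fun=> c).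
Proof. by exists `|c|, 1; split => // t _ _; rewrite mulr1. Qed.

Lemma bigO_hX N : bigO N (fun t => h t ^+ N).
Proof.
exists 1, 1; split => // t _ /andP[ht _].
by rewrite mul1r ger0_norm ?exprn_ge0.
Qed.

Lemma bigOD N f g : bigO N f -> bigO N g -> bigO N (fun t => f t + g t).
Proof.
move=> [C [h0 [C0 h00 H]]] [C' [h0' [C0' h00' H']]].
exists (C + C'), (Num.min h0 h0'); split; first exact: addr_ge0.
  by rewrite lt_min h00.
move=> t Dt /andP[ht0]; rewrite le_min => /andP[ht1 ht2].
rewrite mulrDl (le_trans (ler_normD _ _)) // lerD //.
  by apply: H; rewrite ?ht0.
by apply: H'; rewrite ?ht0.
Qed.

Lemma bigOM N M f g : bigO N f -> bigO M g -> bigO (N + M) (fun t => f t * g t).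
Proof.
move=> [C [h0 [C0 h00 H]]] [C' [h0' [C0' h00' H']]].
exists (C * C'), (Num.min h0 h0'); split; first exact: mulr_ge0.
  by rewrite lt_min h00.
move=> t Dt /andP[ht0]; rewrite le_min => /andP[ht1 ht2].
rewrite exprD mulrACA normrM ler_pM //.
  by apply: H; rewrite ?ht0.
by apply: H'; rewrite ?ht0.
Qed.

Lemma bigO_leq N M g : (M <= N)%N -> bigO N g -> bigO M g.
Proof.
move=> MN [C [h0 [C0 h00 H]]]; exists C, (Num.min h0 1); split => //.
  by rewrite lt_min h00 ltr01.
move=> t Dt /andP[ht0]; rewrite le_min => /andP[ht1 ht2].
apply: le_trans (H t Dt _) _; rewrite ?ht0 //.
by apply: ler_wpM2l => //; exact: ler_wiXn2l.
Qed.

Lemma bigOZ N c g : bigO N g -> bigO N (fun t => c * g t).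
Proof. exact: (bigOM (bigO_cst c)). Qed.

Lemma bigON N g : bigO N g -> bigO N (fun t => - g t).
Proof.
by move=> /(bigOZ (-1)); apply: bigO_eq => t; rewrite mulN1r.
Qed.

Lemma bigOB N f g : bigO N f -> bigO N g -> bigO N (fun t => f t - g t).
Proof. by move=> hf /bigON; exact: bigOD. Qed.

Lemma bigO_sum N (I : Type) (r : seq I) (P : pred I) (F : I -> T -> R) :
  (forall i, P i -> bigO N (F i)) -> bigO N (fun t => \sum_(i <- r | P i) F i t).
Proof.
move=> HF; elim: r => [|i r IH].
  by apply: bigO_eq (bigO_cst0 N) => t; rewrite big_nil.
case: (boolP (P i)) => Pi.
  by apply: bigO_eq (bigOD (HF i Pi) IH) => t; rewrite big_cons Pi.
by apply: bigO_eq IH => t; rewrite big_cons (negPf Pi).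
Qed.

Lemma bigO_hM N g : bigO N g -> bigO N.+1 (fun t => h t * g t).
Proof. exact: (bigOM (bigO_hX 1)). Qed.

Lemma bigO_horner (p : {poly R}) : bigO 0 (fun t => p.[h t]).
Proof.
elim/poly_ind: p => [|p c IH].
  by apply: bigO_eq (bigO_cst0 0) => t; rewrite horner0.
apply: (@bigO_eq _ _ (fun t => p.[h t] * h t + c)) => [t|].
  by rewrite !hornerE.
apply: bigOD (bigO_cst c).
by apply: (@bigO_leq 1) => //; apply: (bigOM IH); exact: (bigO_hX 1).
Qed.

End BigO.

Notation bigO0 := (bigO id (fun=> True)).

(** Carries one-variable estimates over to arguments such as theta h with theta in [0,1]. *)
Lemma bigO_pullback (R : realType) (T : Type) (h : T -> R) (D : T -> Prop) N
    (g : R -> R) (phi : T -> R) :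
  (forall t, D t -> 0 <= h t -> 0 <= phi t <= h t) ->
  bigO0 N g -> bigO h D N (fun t => g (phi t)).
Proof.
move=> hphi [C [h0 [C0 h00 H]]]; exists C, h0; split => // t Dt /andP[ht0 ht1].
have /andP[p0 p1] := hphi t Dt ht0.
apply: le_trans (H _ _ _) _ => //; first by rewrite p0 (le_trans p1).
by apply: ler_wpM2l => //; rewrite lerXn2r ?nnegrE.
Qed.

(** * Functions with a polynomial expansion at 0 *)

Section PolynomialApproximation.
Variable R : realType.
Implicit Types (f g : R -> R) (N : nat).

(** Stands for a one-sided Taylor expansion at 0 with remainder O(x^N). The degree of [p] is left
    free, so that products need no truncation. *)
Definition poly_approx N g := exists p : {poly R}, bigO0 N (fun x => g x - p.[x]).

Lemma poly_approx_bounded N g : poly_approx N g -> bigO0 0 g.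
Proof.
move=> [p hp]; have hb := bigOD (bigO_leq (leq0n N) hp) (bigO_horner id _ p).
by apply: bigO_eq hb => x; rewrite subrK.
Qed.

Lemma poly_approx_eq N f g : f =1 g -> poly_approx N g -> poly_approx N f.
Proof. by move=> fg [p hp]; exists p; apply: bigO_eq hp => x; rewrite fg. Qed.

Lemma poly_approx_poly N (p : {poly R}) : poly_approx N (horner p).
Proof. by exists p; apply: bigO_eq (bigO_cst0 _ _ N) => x; rewrite subrr. Qed.

Lemma poly_approx_cst N c : poly_approx N (fun=> c).
Proof. by apply: poly_approx_eq (poly_approx_poly N c%:P) => x; rewrite hornerC. Qed.

Lemma poly_approxDO N f g : bigO0 N f -> poly_approx N g ->
  poly_approx N (fun x => f x + g x).
Proof.
move=> hf [p hp]; exists p; apply: bigO_eq (bigOD hf hp) => x; by rewrite addrA.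
Qed.

Lemma poly_approxD N f g : poly_approx N f -> poly_approx N g ->
  poly_approx N (fun x => f x + g x).
Proof.
move=> [p hp] [q hq]; exists (p + q); apply: bigO_eq (bigOD hp hq) => x.
by rewrite hornerD opprD addrACA.
Qed.

Lemma poly_approxM N f g : poly_approx N f -> poly_approx N g ->
  poly_approx N (fun x => f x * g x).
Proof.
move=> [p hp] hg; have gb := poly_approx_bounded hg; have [q hq] := hg.
exists (p * q); have h1 := bigOM hp gb; rewrite addn0 in h1.
apply: bigO_eq (bigOD h1 (bigOM (bigO_horner id _ p) hq)) => x.
by rewrite hornerM mulrBl mulrBr addrA subrK.
Qed.

Lemma poly_approxX N f k : poly_approx N f -> poly_approx N (fun x => f x ^+ k).
Proof.
move=> hf; elim: k => [|k IH]; first exact: poly_approx_cst.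
by apply: poly_approx_eq (poly_approxM hf IH) => x; rewrite exprS.
Qed.

Lemma poly_approx_sum N k (F : nat -> R -> R) :
  (forall i, poly_approx N (F i)) -> poly_approx N (fun x => \sum_(i < k) F i x).
Proof.
move=> HF; elim: k => [|k IH].
  by apply: poly_approx_eq (poly_approx_cst N 0) => x; rewrite big_ord0.
by apply: poly_approx_eq (poly_approxD IH (HF k)) => x; rewrite big_ord_recr.
Qed.

End PolynomialApproximation.

(** * Mean value and Taylor bounds in one variable *)

Section MeanValue.
Variable R : realType.

(** The condition [0 <= u * x] asks for the bound only on the side of 0 where [x] lies, as suits the
    one-sided [bigO] estimates. *)
Lemma mean_value_bound (g g' : R -> R) (x B : R) :
  (forall u : R, `|u| <= `|x| -> is_derive u 1 g (g' u)) ->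
  (forall u : R, `|u| <= `|x| -> 0 <= u * x -> `|g' u| <= B) ->
  `|g x - g 0| <= B * `|x|.
Proof.
move=> dg bg.
have cont (a b : R) : (forall u, u \in `[a, b] -> `|u| <= `|x|) ->
    {within `[a, b], continuous g}%classic.
  move=> H; apply: derivable_within_continuous => u /H hu.
  exact: (@ex_derive _ _ _ _ _ _ _ (dg u hu)).
have [x0|x0] := leP 0 x.
  have in0x u : u \in `[0, x] -> `|u| <= `|x|.
    by rewrite in_itv /= => /andP[u0 ux]; rewrite !ger0_norm.
  have [||c hc ->] := @MVT_segment R g g' 0 x x0; last 1 first.
  - rewrite subr0 normrM ler_wpM2r // bg ?in0x //.
    by move: hc; rewrite in_itv /= => /andP[c0 _]; rewrite mulr_ge0.
  - by move=> u hu; apply/dg/in0x; exact: subset_itv_oo_cc hu.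
  - exact: cont in0x.
have inx0 u : u \in `[x, 0] -> `|u| <= `|x|.
  by rewrite in_itv /= => /andP[u0 ux]; rewrite !ler0_norm ?(ltW x0) ?lerN2.
rewrite distrC.
have [||c hc ->] := @MVT_segment R g g' x 0 (ltW x0); last 1 first.
- rewrite sub0r normrM normrN ler_wpM2r // bg ?inx0 //.
  by move: hc; rewrite in_itv /= => /andP[_ c0]; rewrite mulr_le0 // ltW.
- by move=> u hu; apply/dg/inx0; exact: subset_itv_oo_cc hu.
- exact: cont inx0.
Qed.

(** Induction on [N] with the family shifted by one derivative; the mean value theorem then gives
    the constant [B] without a factor 1/N!. *)
Lemma taylor_bound N (phi : nat -> R -> R) (d B : R) :
  (forall k (u : R), `|u| <= `|d| -> is_derive u 1 (phi k) (phi k.+1 u)) ->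
  (forall u : R, `|u| <= `|d| -> `|phi N u| <= B) ->
  `|phi 0%N d - \sum_(k < N) phi k 0 / k`!%:R * d ^+ k| <= B * `|d| ^+ N.
Proof.
elim: N phi d => [|N IH] phi d dphi bphi.
  by rewrite big_ord0 subr0 mulr1 bphi.
pose P M (psi : nat -> R) : {poly R} := \poly_(k < M) (psi k / k`!%:R).
pose g x := phi 0%N x - (P N.+1 (phi^~ 0)).[x].
(* [g'] is the Taylor remainder of order [N] of [phi 1], to which the induction hypothesis
   applies. *)
pose g' x := phi 1%N x - (P N (fun k => phi k.+1 0)).[x].
have dP : (P N.+1 (phi^~ 0))^`() = P N (fun k => phi k.+1 0).
  apply/polyP => k; rewrite coef_deriv !coef_poly ltnS.
  case: ifP => // _; last by rewrite mul0rn.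
  rewrite -[LHS]mulr_natr factS natrM; field.
  by rewrite nat1r !pnatr_eq0 -lt0n fact_gt0.
have g0 : g 0 = 0.
  by rewrite /g horner_coef0 coef_poly fact0 divr1 subrr.
have hE : (P N.+1 (phi^~ 0)).[d] = \sum_(k < N.+1) phi k 0 / k`!%:R * d ^+ k.
  exact: horner_poly.
rewrite -hE.
have := @mean_value_bound g g' d (B * `|d| ^+ N).
rewrite g0 subr0 -mulrA -exprSr; apply.
  move=> u hu; apply: is_deriveB; first exact: dphi.
  by rewrite -dP; exact: is_derive_poly.
move=> u hu _; rewrite /g' horner_poly.
apply: le_trans (IH (fun k => phi k.+1) u _ _) _.
- by move=> k v hv; apply: dphi; exact: le_trans hv hu.
- by move=> v hv; apply: bphi; exact: le_trans hv hu.
apply: ler_wpM2l; last by rewrite lerXn2r ?nnegrE.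
by apply: le_trans (normr_ge0 _) (bphi 0 _); rewrite normr0.
Qed.

Lemma bigO_integrate (g g' : R -> R) (q : {poly R}) (a : R) N : 0 < a ->
  (forall u : R, `|u| < a -> is_derive u 1 g (g' u)) ->
  bigO0 N (fun x => g' x - q.[x]) ->
  bigO0 N.+1 (fun x => g x - g 0 - (prim q).[x]).
Proof.
move=> a0 dg [C [h0 [C0 h00 H]]]; exists C, (Num.min h0 (a / 2)); split => //.
  by rewrite lt_min h00 divr_gt0.
move=> x _ /andP[x0]; rewrite le_min => /andP[xh xa].
have := @mean_value_bound (fun x => g x - (prim q).[x]) (fun x => g' x - q.[x])
  x (C * x ^+ N).
rewrite prim_horner0 subr0 (ger0_norm x0) -mulrA -exprSr addrAC; apply.
  move=> u hu; apply: is_deriveB; first by apply: dg; lra.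
  by rewrite -[in X in is_derive _ _ _ X](deriv_prim q); exact: is_derive_poly.
move=> u hu ux; have [u0|u0] := leP 0 u.
  rewrite ger0_norm // in hu.
  rewrite (le_trans (H u I _)) ?u0 ?(le_trans hu) //.
  by rewrite ler_wpM2l // lerXn2r ?nnegrE.
(* With u < 0 and 0 <= u x, only x = 0 remains, and then |u| <= |x| contradicts u < 0. *)
have x0' : x = 0 by apply/eqP; rewrite eq_le x0 andbT; nra.
move: hu; rewrite x0' => hu.
have u0' : u = 0 by apply/eqP; rewrite -normr_eq0 eq_le hu normr_ge0.
by rewrite u0' ltxx in u0.
Qed.

End MeanValue.

(** * Taylor estimates for smooth vector fields *)

Section MatrixNorm.
Variables (R : realType) (m n : nat).
Implicit Types M : 'M[R]_(m, n).

Lemma matrix_entry_norm M i j : `|M i j| <= `|M|.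
Proof.
by rewrite [leRHS]/Num.Def.normr /= mx_normrE (le_bigmax _ _ (i, j)).
Qed.

Lemma matrix_norm_le M c : 0 <= c -> (forall i j, `|M i j| <= c) -> `|M| <= c.
Proof.
by move=> c0 H; rewrite [leLHS]/Num.Def.normr /= mx_normrE bigmax_le.
Qed.

End MatrixNorm.

Section RowNorm.
Variables (R : realType) (n : nat).
Implicit Types v : 'rV[R]_n.

Lemma row_norm_le v c : 0 <= c -> (forall j, `|v 0 j| <= c) -> `|v| <= c.
Proof. by move=> c0 H; apply: matrix_norm_le => // i j; rewrite ord1. Qed.

Lemma row_matrix_norm m (M : 'M[R]_(m, n)) i : `|row i M| <= `|M|.
Proof. by apply: row_norm_le => // j; rewrite mxE matrix_entry_norm. Qed.

Lemma row_norm_sum v : `|v| <= \sum_j `|v 0 j|.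
Proof.
apply: row_norm_le => [|j]; first by apply: sumr_ge0.
by rewrite (bigD1 j) //= lerDl sumr_ge0.
Qed.

End RowNorm.

Section SmoothField.
Variables (R : realType) (n : nat) (f : 'rV[R]_n -> 'rV[R]_n).
Hypothesis f_smooth : smooth f.
Implicit Types (vs : seq 'rV[R]_n) (z v : 'rV[R]_n) (r : 'I_n).

Local Notation F vs r z := (iderive vs f z 0 r).
Local Notation e j := (@delta_mx R 1 n 0 j).

(** The difference quotients on the line and in the direction [v] are the same function, so no chain
    rule is involved. *)
Lemma is_derive_line vs r z v (t : R) :
  is_derive t 1 (fun u : R => F vs r (z + u *: v)) (F (v :: vs) r (z + t *: v)).
Proof.
have [_ dv] := f_smooth vs; set g := iderive vs f in dv *.
have E : (fun h : R => h^-1 *: (((fun u : R => g (z + u *: v)) \o shift t) (h *: 1)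
     - g (z + t *: v))) =
   (fun h : R => h^-1 *: ((g \o shift (z + t *: v)) (h *: v) - g (z + t *: v))).
  apply/funext => h /=; congr (_ *: (g _ - _)).
  by rewrite scalerDl addrA [_ *: 1]mulr1 addrAC [LHS]addrC addrA.
have d1 : derivable (fun u : R => g (z + u *: v)) t 1.
  by have := dv (z + t *: v) v; rewrite /derivable E.
have d2 : 'D_1 (fun u : R => g (z + u *: v)) t = derive g (z + t *: v) v.
  by rewrite /derive E.
have dr := (derivable_mxP _ _ _).1 d1 0 r.
apply: DeriveDef => //.
by rewrite /= -/g -d2 derive_mx // mxE.
Qed.

Lemma taylor_line N vs r z v (d B : R) :
  (forall t : R, `|t| <= `|d| -> `|F (nseq N v ++ vs) r (z + t *: v)| <= B) ->
  `|F vs r (z + d *: v) -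
    \sum_(k < N) F (nseq k v ++ vs) r z / k`!%:R * d ^+ k| <= B * `|d| ^+ N.
Proof.
move=> HB.
have := @taylor_bound R N (fun k t => F (nseq k v ++ vs) r (z + t *: v)) d B.
rewrite scale0r addr0; apply => // k u _; exact: is_derive_line.
Qed.

Lemma iderive_locally_bounded (I : finType) (vs : I -> seq 'rV[R]_n)
    (y0 : 'rV[R]_n) : exists B rho : R, [/\ 0 <= B, 0 < rho &
  forall i r z, `|z - y0| <= rho -> `|F (vs i) r z| <= B].
Proof.
pose B := \sum_i (`|iderive (vs i) f y0| + 1).
have B0 : 0 <= B by apply: sumr_ge0 => i _; rewrite addr_ge0.
have near1 i :
    (\forall z \near y0, `|iderive (vs i) f y0 - iderive (vs i) f z| <= 1)%classic.
  have [cv _] := f_smooth (vs i).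
  by have /cvgrPdist_le := cv y0; apply; exact: ltr01.
have := filter_forall (nbhs_filter y0) near1.
move=> /nbhs_normP[rho /= rho0 H]; exists B, (rho / 2); split => //.
  by rewrite divr_gt0.
move=> i r z hz; apply: le_trans (matrix_entry_norm _ 0 _) _.
have {}H : `|iderive (vs i) f y0 - iderive (vs i) f z| <= 1.
  by apply: H => /=; rewrite distrC; apply: le_lt_trans hz _; lra.
rewrite /B (bigD1 i) //= -[leLHS]addr0 lerD //; last first.
  by apply: sumr_ge0 => j _; rewrite addr_ge0.
by rewrite -lerBlDl (le_trans (lerB_dist _ _)) // distrC.
Qed.

(* Moving from [z] to [z'] one coordinate at a time reduces every estimate to
   one-variable Taylor bounds along basis vectors, so that neither the Frechet
   differentiability of [f] nor a chain rule is needed. *)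
Definition mix z z' (m : nat) : 'rV[R]_n :=
  \row_j (if (j < m)%N then z' 0 j else z 0 j).

Lemma mix0 z z' : mix z z' 0 = z.
Proof. by apply/rowP => j; rewrite mxE. Qed.

Lemma mixn z z' : mix z z' n = z'.
Proof. by apply/rowP => j; rewrite mxE ltn_ord. Qed.

Lemma mixS z z' (j : 'I_n) :
  mix z z' j.+1 = mix z z' j + (z' 0 j - z 0 j) *: e j.
Proof.
apply/rowP => i; rewrite !mxE eqxx /= ltnS leq_eqVlt.
have [->|ne] := eqVneq i j; first by rewrite eqxx /= ltnn mulr1 addrC subrK.
by rewrite val_eqE (negPf ne) /= mulr0 addr0.
Qed.

(** A coordinate of the mixed point is within [D] of that of [y0], and the increment is at most 2D.
    The radii [rho / 3] below come from this factor 3. *)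
Lemma mix_ball (y0 : 'rV[R]_n) z z' m (j : 'I_n) (t D : R) :
  `|z - y0| <= D -> `|z' - y0| <= D ->
  `|t| <= `|z' 0 j - z 0 j| -> `|mix z z' m + t *: e j - y0| <= 3 * D.
Proof.
move=> hz hz' ht; have D0 : 0 <= D by apply: le_trans hz.
apply: row_norm_le => [|i]; first by lra.
have := le_trans (matrix_entry_norm (z - y0) 0 i) hz.
have := le_trans (matrix_entry_norm (z' - y0) 0 i) hz'.
have := le_trans (matrix_entry_norm (z - y0) 0 j) hz.
have := le_trans (matrix_entry_norm (z' - y0) 0 j) hz'.
rewrite !mxE eqxx /= => a1 a2 a3 a4.
have ht2 : `|t| <= 2 * D.
  apply: le_trans ht _.
  have -> : z' 0 j - z 0 j = (z' 0 j - y0 0 j) - (z 0 j - y0 0 j) by ring.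
  by rewrite (le_trans (ler_normB _ _)) //; lra.
have hb (b : bool) : `|t * b%:R| <= 2 * D.
  by case: b; rewrite ?mulr1 // mulr0 normr0; lra.
rewrite addrAC (le_trans (ler_normD _ _)) //.
have := hb (i == j); case: ifP => _; lra.
Qed.

(** Induction on the number of coordinates already moved to [u x]. The Taylor coefficients in the
    next coordinate are covered by the induction hypothesis, which holds for all [vs]; the increment
    is O(x), so the remainder is O(x^N). *)
Lemma poly_approx_comp N (u : R -> 'rV[R]_n) (y0 : 'rV[R]_n) :
  (forall j, bigO0 1 (fun x => u x 0 j - y0 0 j)) ->
  (forall j, poly_approx N (fun x => u x 0 j)) ->
  forall vs r, poly_approx N (fun x => F vs r (u x)).
Proof.
move=> u1 uN.
suff H m : (m <= n)%N -> forall vs r,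
    poly_approx N (fun x => F vs r (mix y0 (u x) m)).
  move=> vs r; apply: poly_approx_eq (H n (leqnn n) vs r) => x; by rewrite mixn.
elim: m => [|m IH] hm vs r.
  by apply: poly_approx_eq (poly_approx_cst N (F vs r y0)) => x; rewrite mix0.
pose j := Ordinal hm; pose d x := u x 0 j - y0 0 j.
pose T x :=
  \sum_(k < N) F (nseq k (e j) ++ vs) r (mix y0 (u x) m) / k`!%:R * d x ^+ k.
have [B [rho [B0 rho0 HB]]] :=
  iderive_locally_bounded (fun _ : unit => nseq N (e j) ++ vs) y0.
have : bigO0 N (fun x => F vs r (mix y0 (u x) m.+1) - T x).
  have : bigO0 1 (fun x => \sum_i `|u x 0 i - y0 0 i|).
    by apply: bigO_sum => i _; exact: bigO_norm.
  move=> [C1 [h1 [C10 h10 H1]]].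
  have [C2 [h2 [C20 h20 H2]]] := u1 j.
  (* The increment is at most [C2 * x], and the cap involving [rho] keeps the whole segment in the
     ball where [B] is valid. *)
  exists (B * C2 ^+ N), (Num.min (Num.min h1 h2) (rho / (3 * (C1 + 1)))); split.
  - by rewrite mulr_ge0 ?exprn_ge0.
  - by rewrite !lt_min h10 h20 divr_gt0 // mulr_gt0 //; lra.
  move=> x _ /andP[x0]; rewrite !le_min => /andP[/andP[xh1 xh2] xr].
  rewrite (mixS y0 (u x) j).
  apply: le_trans (taylor_line _) _ => [t ht|].
    apply: (HB tt).
    have hu : `|u x - y0| <= C1 * x.
      apply: le_trans (row_norm_sum _) _.
      have := H1 x I; rewrite x0 xh1 expr1 => /(_ isT).
      rewrite ger0_norm ?sumr_ge0 //; apply: le_trans; rewrite le_eqVlt.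
      by apply/orP; left; apply/eqP/eq_bigr => i _; rewrite !mxE.
    apply: le_trans (@mix_ball y0 y0 (u x) m j t (C1 * x) _ hu ht) _.
      by rewrite subrr normr0 mulr_ge0.
    have : x * (3 * (C1 + 1)) <= rho by rewrite -ler_pdivlMr //; lra.
    by nra.
  rewrite -mulrA ler_wpM2l // -exprMn lerXn2r ?nnegrE ?mulr_ge0 //.
  by have := H2 x I; rewrite x0 xh2 expr1; exact.
move=> hT.
have hT' : poly_approx N T.
  apply: (@poly_approx_sum _ N N (fun k x =>
    F (nseq k (e j) ++ vs) r (mix y0 (u x) m) / k`!%:R * d x ^+ k)) => k.
  apply: poly_approxM; first apply: poly_approxM.
  - by apply: IH; exact: ltnW.
  - exact: poly_approx_cst.
  - apply: poly_approxX; apply: poly_approxD; [exact: uN|exact: poly_approx_cst].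
by apply: poly_approx_eq (poly_approxDO hT hT') => x; rewrite subrK.
Qed.

(** Telescoping over coordinates. Intermediate points [mix z z' m] are included because the
    linearization compares derivatives there with those at [z]. *)
Lemma iderive_lipschitz (I : finType) (vs : I -> seq 'rV[R]_n) (y0 : 'rV[R]_n) :
  exists L rho : R, [/\ 0 <= L, 0 < rho &
  forall i r z z', `|z - y0| <= rho -> `|z' - y0| <= rho ->
    forall m, (m <= n)%N ->
      `|F (vs i) r (mix z z' m) - F (vs i) r z| <= L * `|z' - z|].
Proof.
have [B [rho [B0 rho0 HB]]] :=
  iderive_locally_bounded (fun p : I * 'I_n => e p.2 :: vs p.1) y0.
exists (n%:R * B), (rho / 3); split; first by rewrite mulr_ge0.
  by rewrite divr_gt0.
move=> i r z z' hz hz' m hm.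
apply: (@le_trans _ _ (m%:R * B * `|z' - z|)); last first.
  by rewrite !ler_wpM2r // ler_nat.
elim: m hm => [|m IH] hm; first by rewrite mix0 subrr normr0 !mul0r.
pose j := Ordinal hm; rewrite -(subrKA (F (vs i) r (mix z z' m))).
rewrite -natr1 2!mulrDl mul1r [leRHS]addrC (le_trans (ler_normD _ _)) //.
rewrite lerD ?IH ?(ltnW hm) // (mixS z z' j).
have := @taylor_line 1 (vs i) r (mix z z' m) (e j) (z' 0 j - z 0 j) B.
rewrite big_ord1 fact0 divr1 mulr1 expr1 => H.
apply: le_trans (H _) _ => [t ht|].
  apply: (HB (i, j)).
  by apply: le_trans (@mix_ball y0 z z' m j t (rho / 3) hz hz' ht) _; lra.
rewrite ler_wpM2l // (le_trans _ (matrix_entry_norm _ 0 j)) //.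
by rewrite [in leRHS]mxE [in leRHS]mxE.
Qed.

Lemma iderive_linearization vs (y0 : 'rV[R]_n) : exists C rho : R,
  [/\ 0 <= C, 0 < rho &
  forall r z z', `|z - y0| <= rho -> `|z' - y0| <= rho ->
    `|F vs r z' - F vs r z - \sum_j (z' 0 j - z 0 j) * F (e j :: vs) r z|
       <= C * `|z' - z| ^+ 2].
Proof.
have [B [rho [B0 rho0 HB]]] :=
  iderive_locally_bounded (fun j => [:: e j, e j & vs]) y0.
have [L [rho' [L0 rho0' HL]]] := iderive_lipschitz (fun j => e j :: vs) y0.
exists (n%:R * (B + L)), (Num.min (rho / 3) rho'); split.
- by rewrite mulr_ge0 ?addr_ge0.
- by rewrite lt_min rho0' divr_gt0.
move=> r z z'; rewrite !le_min => /andP[hz1 hz2] /andP[hz1' hz2'].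
set G := fun j => (z' 0 j - z 0 j) * F (e j :: vs) r z.
suff H m : (m <= n)%N ->
    `|F vs r (mix z z' m) - F vs r z - \sum_(j < n | (j < m)%N) G j|
      <= m%:R * (B + L) * `|z' - z| ^+ 2.
  have := H n (leqnn n); rewrite mixn.
  by under eq_bigl do rewrite ltn_ord.
elim: m => [|m IH] hm.
  by rewrite mix0 subrr sub0r normrN big1 ?normr0 ?mul0r //.
pose j := Ordinal hm; rewrite (bigD1 j) ?ltnSn //=.
have -> : \sum_(i < n | (i < m.+1)%N && (i != j)) G i =
          \sum_(i < n | (i < m)%N) G i.
  apply: eq_bigl => i; rewrite ltnS leq_eqVlt -(inj_eq val_inj) /=.
  by case: eqP => [->|]; rewrite ?ltnn ?andbT ?andbF.
set S := bigop _ _ _ in IH *.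
set a := F vs r (mix z z' m) in IH *; set a' := F vs r (mix z z' m.+1).
set b := F (e j :: vs) r (mix z z' m); set d := z' 0 j - z 0 j.
(* Three errors: the earlier coordinates, the second-order Taylor remainder in coordinate [j], and
   the change of base point of the derivative from the mixed point to [z]. *)
have -> : a' - F vs r z - (G j + S) =
   (a - F vs r z - S) + (a' - (a + b * d)) + d * (b - F (e j :: vs) r z).
  by rewrite /G -/d; ring.
have hd : `|d| <= `|z' - z|.
  apply: le_trans (matrix_entry_norm _ 0 j).
  by rewrite [in leRHS]mxE [in leRHS]mxE.
have -> : m.+1%:R * (B + L) * `|z' - z| ^+ 2 =
    m%:R * (B + L) * `|z' - z| ^+ 2 + B * `|z' - z| ^+ 2 + L * `|z' - z| ^+ 2.
  by rewrite -natr1; ring.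
apply: le_trans (ler_normD _ _) _; apply: lerD.
  apply: le_trans (ler_normD _ _) _; apply: lerD; first by rewrite IH // ltnW.
  have := @taylor_line 2 vs r (mix z z' m) (e j) d B.
  rewrite big_ord_recr big_ord1 /= fact0 !divr1 mulr1 expr1 -(mixS z z' j).
  move=> H; apply: le_trans (H _) _ => [t ht|].
    apply: HB.
    by apply: le_trans (@mix_ball y0 z z' m j t (rho / 3) hz1 hz1' ht) _; lra.
  by rewrite ler_wpM2l // lerXn2r ?nnegrE.
rewrite normrM expr2 mulrA [L * _]mulrC -mulrA ler_pM // HL //.
exact: ltnW.
Qed.

End SmoothField.

(** * Expansion of the exact solution *)

Section LocalSolution.
Variables (R : realType) (n : nat) (f : 'rV[R]_n -> 'rV[R]_n).
Hypothesis f_smooth : smooth f.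
Variables (t0 a : R) (y : R -> 'rV[R]_n).
Hypothesis a0 : 0 < a.
Hypothesis y_sol : forall t, t0 - a < t < t0 + a -> is_derive t 1 y (f (y t)).

Lemma is_derive_shifted_entry r (x : R) : `|x| < a ->
  is_derive x 1 (fun x : R => y (t0 + x) 0 r) (f (y (t0 + x)) 0 r).
Proof.
rewrite ltr_norml => /andP[xa1 xa2].
have [dy vy] : is_derive (t0 + x) 1 y (f (y (t0 + x))) by apply: y_sol; lra.
have E : (fun h : R => h^-1 *: (((fun u : R => y (t0 + u)) \o shift x) (h *: 1)
     - y (t0 + x))) =
   (fun h : R => h^-1 *: ((y \o shift (t0 + x)) (h *: 1) - y (t0 + x))).
  by apply/funext => h /=; congr (_ *: (y _ - _)); rewrite addrCA.
have d1 : derivable (fun u : R => y (t0 + u)) x 1.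
  by move: dy; rewrite /derivable E.
have d2 : 'D_1 (fun u : R => y (t0 + u)) x = f (y (t0 + x)).
  by rewrite -vy /derive E.
have dr := (derivable_mxP _ _ _).1 d1 0 r.
apply: DeriveDef => //.
by rewrite -d2 derive_mx // mxE.
Qed.

Lemma solution_near (rho : R) : 0 < rho -> exists2 d : R, 0 < d &
  forall x, 0 <= x <= d -> `|y (t0 + x) - y t0| <= rho.
Proof.
move=> rho0; have [dy _] : is_derive t0 1 y (f (y t0)).
  by apply: y_sol; rewrite ltrBlDr !ltrDl a0.
have /derivable1_diffP/differentiable_continuous := dy.
move=> /cvgrPdist_le /(_ rho rho0) /nbhs_normP[d /= d0 Hd].
exists (d / 2) => [|x /andP[x0 xd]]; first by rewrite divr_gt0.
rewrite distrC; apply: Hd => /=.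
rewrite opprD addrA subrr sub0r normrN ger0_norm //.
by apply: le_lt_trans xd _; rewrite ltr_pdivrMr // ltr_pMr // ltr1n.
Qed.

(** Bootstrapping as in Picard iteration: an expansion of f(y) to order N integrates to one of y to
    order N+1, and composition with [f] returns order N+1 for f(y). *)
Lemma solution_approx N :
  (forall r, bigO0 1 (fun x => y (t0 + x) 0 r - y t0 0 r)) /\
  exists q : 'I_n -> {poly R}, forall r,
  bigO0 N (fun x => f (y (t0 + x)) 0 r - (q r).[x]) /\
  bigO0 N.+1 (fun x => y (t0 + x) 0 r - y t0 0 r - (prim (q r)).[x]).
Proof.
have int (q : {poly R}) r M : bigO0 M (fun x => f (y (t0 + x)) 0 r - q.[x]) ->
    bigO0 M.+1 (fun x => y (t0 + x) 0 r - y t0 0 r - (prim q).[x]).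
  move=> hq.
  have := @bigO_integrate R _ _ q a M a0 (@is_derive_shifted_entry r) hq.
  by rewrite addr0.
(* Order 0 with the zero polynomial only says that f(y) is bounded near [t0]. *)
have base r : bigO0 0 (fun x => f (y (t0 + x)) 0 r - (0 : {poly R}).[x]).
  have [B [rho [B0 rho0 HB]]] :=
    iderive_locally_bounded f_smooth (fun _ : unit => [::]) (y t0).
  have [d d0 Hd] := solution_near rho0; exists B, d; split => //.
  by move=> x _ hx; rewrite horner0 subr0 mulr1; exact: (HB tt r) (Hd x hx).
have h1 j : bigO0 1 (fun x => y (t0 + x) 0 j - y t0 0 j).
  by apply: bigO_eq (int _ _ _ (base j)) => x; rewrite raddf0 horner0 subr0.
split=> //; suff [q hq] : exists q : 'I_n -> {poly R}, forall r,
    bigO0 N (fun x => f (y (t0 + x)) 0 r - (q r).[x]).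
  by exists q => r; split; [|exact: int].
elim: N => [|N [q hq]]; first by exists (fun=> 0).
have hN j : poly_approx N.+1 (fun x => y (t0 + x) 0 j).
  exists ((y t0 0 j)%:P + prim (q j)); apply: bigO_eq (int _ _ _ (hq j)) => x.
  by rewrite hornerD hornerC opprD addrA.
have H r := poly_approx_comp f_smooth h1 hN [::] r.
by have [q' hq'] := choice H; exists q'.
Qed.

End LocalSolution.

(** * Local error *)

Section LocalError.
Variables (R : realType) (k s : nat) (tau : 'I_k -> R).
Hypothesis s_gt0 : (0 < s)%N.
Hypothesis tau01 : forall i, 0 <= tau i <= 1.
Hypothesis exact : quad_exact_upto tau s.*2.
Variables (n : nat) (f : 'rV[R]_n -> 'rV[R]_n).
Hypothesis f_smooth : smooth f.
Variables (t0 a : R) (y : R -> 'rV[R]_n).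
Hypothesis a0 : 0 < a.
Hypothesis y_sol : forall t, t0 - a < t < t0 + a -> is_derive t 1 y (f (y t)).
Variables (delta L C : R).
Hypothesis delta_gt0 : 0 < delta.
Hypothesis L_ge0 : 0 <= L.
Hypothesis C_ge0 : 0 <= C.
Hypothesis f_lip : forall r z z', `|z - y t0| <= delta -> `|z' - y t0| <= delta ->
  `|f z' 0 r - f z 0 r| <= L * `|z' - z|.
Hypothesis f_lin : forall r z z', `|z - y t0| <= delta -> `|z' - y t0| <= delta ->
  `|f z' 0 r - f z 0 r -
    \sum_j (z' 0 j - z 0 j) * iderive [:: delta_mx 0 j] f z 0 r|
     <= C * `|z' - z| ^+ 2.

Local Notation w := (qweight tau).
Local Notation A := (hbvmA s tau).

(* A parameter [t] is a pair of a stepsize [t.1] and a stage vector [t.2]. *)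
Local Notation T := (R * ('I_k -> 'rV[R]_n))%type.
(** Bounds on this domain are uniform in the stage vector, hence hold for every solution of the
    stage equations in the ball. *)
Definition near_stages (t : T) : Prop :=
  rk_stages A t.1 f (y t0) t.2 /\ forall i, `|t.2 i - y t0| <= delta.
Local Notation O := (bigO (fun t : T => t.1) near_stages).

Definition exact_stage (l : 'I_k) (t : T) : 'rV[R]_n := y (t0 + tau l * t.1).
Definition stage_error (l : 'I_k) (r : 'I_n) (t : T) : R :=
  t.2 l 0 r - exact_stage l t 0 r.
Definition field_error (l : 'I_k) (r : 'I_n) (t : T) : R :=
  f (t.2 l) 0 r - f (exact_stage l t) 0 r.
(** The residual of the exact solution in a Runge-Kutta equation: a row of [A] with its abscissa
    gives a stage, the weights with [theta = 1] give the final step. *)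
Definition defect (c : 'I_k -> R) (theta : R) (r : 'I_n) (t : T) : R :=
  y t0 0 r + t.1 * (\sum_j c j * f (exact_stage j t) 0 r) - y (t0 + theta * t.1) 0 r.

Let scaled_le (theta : R) (t : T) : 0 <= theta <= 1 -> near_stages t -> 0 <= t.1 ->
  0 <= theta * t.1 <= t.1.
Proof.
by move=> /andP[th0 th1] _ ht; rewrite mulr_ge0 //= ler_piMl.
Qed.

Lemma st_near : exists2 h1 : R, 0 < h1 &
  forall t : T, near_stages t -> 0 <= t.1 <= h1 ->
    forall l, `|exact_stage l t - y t0| <= delta.
Proof.
have [d d0 Hd] := solution_near a0 y_sol delta_gt0.
exists d => // t Dt /andP[h0 hd] l.
have /andP[p1 p2] := scaled_le (tau01 l) Dt h0.
by apply: Hd; rewrite p1 (le_trans p2).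
Qed.

(** With f(y) expanded in powers of the stepsize, the coefficient of h^(p+1) is a multiple of the
    p-th order condition. The weights [v] let one statement cover a single stage, the final step and
    moments of all stage defects. *)
Lemma defect_order (I : finType) (v : I -> R) (c : I -> 'I_k -> R)
    (theta : I -> R) M : (forall i, 0 <= theta i <= 1) ->
  (forall p, (p < M)%N -> \sum_i v i *
     (\sum_j c i j * tau j ^+ p - (prim 'X^p).[theta i]) = 0) ->
  forall r, O M.+1 (fun t => \sum_i v i * defect (c i) (theta i) r t).
Proof.
move=> th01 Hp r; have [_ [q hq]] := solution_approx f_smooth a0 y_sol M.
have [fq yq] := hq r; set Q := q r in fq yq.
pose m p : R := \sum_i v i * (\sum_j c i j * tau j ^+ p - (prim 'X^p).[theta i]).
pose r1 (t : T) := \sum_i v i *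
  (t.1 * \sum_j c i j * (f (exact_stage j t) 0 r - Q.[tau j * t.1])).
pose r2 (t : T) := \sum_i v i *
  (y (t0 + theta i * t.1) 0 r - y t0 0 r
   - (prim Q).[theta i * t.1]).
apply: (@bigO_eq _ _ _ _ _ _
  (fun t => \sum_(p < size Q) Q`_p * m p * t.1 ^+ p.+1 + (r1 t - r2 t))) => [t|].
  rewrite /r1 /r2 -sumrB.
  under [X in X + _]eq_bigr do rewrite mulrAC mulr_sumr.
  rewrite exchange_big /= -big_split; apply: eq_bigr => i _ /=.
  have -> : defect (c i) (theta i) r t =
     t.1 * (\sum_j c i j * (f (exact_stage j t) 0 r - Q.[tau j * t.1]))
     - (y (t0 + theta i * t.1) 0 r - y t0 0 r - (prim Q).[theta i * t.1])
     + (t.1 * (\sum_j c i j * Q.[tau j * t.1]) - (prim Q).[theta i * t.1]).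
    under eq_bigr do rewrite mulrBr.
    by rewrite sumrB /defect; ring.
  have -> : t.1 * (\sum_j c i j * Q.[tau j * t.1]) - (prim Q).[theta i * t.1]
     = \sum_(p < size Q) Q`_p * t.1 ^+ p.+1 *
         (\sum_j c i j * tau j ^+ p - (prim 'X^p).[theta i]).
    under [in RHS]eq_bigr do rewrite mulrBr mulr_sumr.
    rewrite sumrB exchange_big horner_prim_scale mulr_sumr /=.
    congr (_ - _); last by apply: eq_bigr => p _; ring.
    apply: eq_bigr => j _; rewrite horner_coef !mulr_sumr.
    by apply: eq_bigr => p _; rewrite exprMn exprS; ring.
  rewrite mulrDr mulrBr addrC; congr (_ + _); rewrite mulr_sumr.
  by apply: eq_bigr => p _; ring.
apply: bigOD; last apply: bigOB.
(* For p < M the order condition removes the term; for larger p the power of the stepsize is high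
   enough. *)
- apply: bigO_sum => p _; have [pM|Mp] := ltnP p M.
    by apply: bigO_eq (bigO_cst0 _ _ _) => t; rewrite /m Hp // mulr0 mul0r.
  by apply: bigOZ; apply: bigO_leq (bigO_hX _ _ _).
- apply: bigO_sum => i _; apply: bigOZ; apply: bigO_hM.
  apply: bigO_sum => j _; apply: bigOZ.
  by apply: (bigO_pullback _ fq) => t Dt ht; exact: scaled_le.
apply: bigO_sum => i _; apply: bigOZ.
by apply: (bigO_pullback _ yq) => t Dt ht; exact: scaled_le.
Qed.

Lemma stage_error_eq l r t : near_stages t ->
  stage_error l r t =
    t.1 * (\sum_j A l j * field_error j r t) + defect (A l) (tau l) r t.
Proof.
move=> [Yst _]; rewrite /stage_error /defect {1}Yst !mxE summxE.
under eq_bigr do rewrite mxE.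
under [in RHS]eq_bigr do rewrite /field_error mulrBr.
rewrite sumrB -/(exact_stage l t); ring.
Qed.

Lemma stage_defect_order l r : O s.+1 (defect (A l) (tau l) r).
Proof.
have := @defect_order 'I_1 (fun=> 1) (fun=> A l) (fun=> tau l) s (fun=> tau01 l).
move=> /(_ _ r) H; apply: bigO_eq (H _) => [t|p ps].
  by rewrite big_ord1 mul1r.
rewrite big_ord1 mul1r.
under eq_bigr do rewrite -hornerXn.
by rewrite hbvmA_C ?subrr // size_polyXn.
Qed.

(** The sum of all entries satisfies err <= h K err + O(h^(s+1)), and the first term is absorbed for
    small h. *)
Lemma stage_error_order l r : O s.+1 (stage_error l r).
Proof.
pose kappa l := \sum_j `|A l j| * L.
pose K := \sum_l \sum_(r < n) kappa l.
have K0 : 0 <= K.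
  by do 3!(apply: sumr_ge0 => ? _); rewrite mulr_ge0.
have [h1 h10 H1] := st_near.
pose err t := \sum_l \sum_r `|stage_error l r t|.
pose dsum t := \sum_l \sum_r `|defect (A l) (tau l) r t|.
have errE l' r' t : `|stage_error l' r' t| <= err t.
  rewrite /err (bigD1 l') //= (bigD1 r') //= -addrA lerDl addr_ge0 ?sumr_ge0 //.
  by move=> i _; exact: sumr_ge0.
(* The cap [(2 * (K + 1))^-1] gives h K <= 1/2, whence the factor 2. *)
have err_le t : near_stages t -> 0 <= t.1 <= Num.min h1 (2 * (K + 1))^-1 ->
    err t <= 2 * dsum t.
  move=> Dt; rewrite le_min => /andP[ht0 /andP[ht1 ht2]].
  have step : err t <= t.1 * K * err t + dsum t.
    have -> : t.1 * K * err t + dsum t =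
        \sum_i \sum_q (t.1 * (kappa i * err t) + `|defect (A i) (tau i) q t|).
      rewrite /K -mulrA mulr_suml mulr_sumr -big_split /=; apply: eq_bigr => i _.
      by rewrite mulr_suml mulr_sumr -big_split.
    apply: ler_sum => i _; apply: ler_sum => q _.
    rewrite (stage_error_eq i q Dt) (le_trans (ler_normD _ _)) // lerD //.
    rewrite normrM (ger0_norm ht0) ler_wpM2l // mulr_suml.
    apply: le_trans (ler_norm_sum _ _ _) _; apply: ler_sum => j _.
    rewrite normrM -mulrA ler_wpM2l //.
    apply: le_trans (f_lip _ (H1 t Dt _ j) (Dt.2 j)) _; first by rewrite ht0.
    apply: ler_wpM2l => //; apply: le_trans (row_norm_sum _) _.
    rewrite /err [leRHS](bigD1 j) //= -[leLHS]addr0 lerD //.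
      by apply: ler_sum => b _; rewrite !mxE.
    by apply: sumr_ge0 => b _; exact: sumr_ge0.
  have err0 : 0 <= err t by apply: sumr_ge0 => b _; exact: sumr_ge0.
  have hK : t.1 * (2 * (K + 1)) <= 1.
    by rewrite -ler_pdivlMr ?mul1r //; lra.
  have : t.1 * K * err t <= 2^-1 * err t by apply: ler_wpM2r => //; nra.
  lra.
apply: (@bigO_le_norm _ _ _ _ _ _ (fun t => 2 * dsum t)
  (Num.min h1 (2 * (K + 1))^-1)) => [|t Dt ht|].
- by rewrite lt_min h10 invr_gt0; lra.
- apply: le_trans (errE l r t) _; apply: le_trans (err_le t Dt ht) _.
  exact: ler_norm.
apply: bigOZ; apply: bigO_sum => i _; apply: bigO_sum => j _.
exact/bigO_norm/stage_defect_order.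
Qed.

Definition moment (g : {poly R}) (r : 'I_n) (t : T) :=
  \sum_l w l * g.[tau l] * stage_error l r t.

(** Linearization costs the square of the stage error. The derivative of [f] along the exact
    solution is then replaced by a polynomial in tau h up to O(h^s), which leaves moments of the
    stage error against [g * 'X^p], each with a factor h^p. *)
Lemma df_moment_order (g : {poly R}) m r : (size g <= m)%N ->
  (forall m' (g' : {poly R}), (m <= m')%N -> (size g' <= m')%N ->
     forall r, O (s.*2.+1 - m') (moment g' r)) ->
  O (s.*2.+1 - m) (fun t => \sum_l w l * g.[tau l] * field_error l r t).
Proof.
move=> hg IH; have [h1 h10 H1] := st_near.
have [y1 [q hq]] := solution_approx f_smooth a0 y_sol s.
pose dfj j z := iderive [:: delta_mx 0 j] f z 0 r.
pose lin l t := \sum_j stage_error l j t * dfj j (exact_stage l t).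
apply: (@bigO_eq _ _ _ _ _ _ (fun t =>
    \sum_l w l * g.[tau l] * (field_error l r t - lin l t) +
    \sum_j \sum_l w l * g.[tau l] *
      (stage_error l j t * dfj j (exact_stage l t)))) => [t|].
  rewrite exchange_big /= -big_split; apply: eq_bigr => l _ /=.
  by rewrite -mulr_sumr -mulrDr subrK.
apply: bigOD.
  apply: bigO_sum => l _; apply: bigOZ; apply: (@bigO_leq _ _ _ _ (s.+1 + s.+1)%N).
    by lia.
  apply: (@bigO_le_norm _ _ _ _ _ _ (fun t =>
      C * ((\sum_j `|stage_error l j t|) * (\sum_j `|stage_error l j t|))) h1) => //.
    move=> t Dt ht; apply: le_trans (f_lin _ (H1 t Dt ht l) (Dt.2 l)) _.
    apply: le_trans (ler_norm _); apply: ler_wpM2l => //.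
    have hE : `|t.2 l - exact_stage l t| <= \sum_j `|stage_error l j t|.
      by apply: le_trans (row_norm_sum _) _; apply: ler_sum => j _; rewrite !mxE.
    by rewrite expr2 ler_pM.
  by apply: bigOZ; apply: bigOM; apply: bigO_sum => j _;
    exact/bigO_norm/stage_error_order.
apply: bigO_sum => j _.
have ys i : poly_approx s (fun x => y (t0 + x) 0 i).
  exists ((y t0 0 i)%:P + prim (q i)).
  apply: bigO_eq (bigO_leq (leqnSn s) (hq i).2) => x.
  by rewrite hornerD hornerC opprD addrA.
have [G hG] := poly_approx_comp f_smooth y1 ys [:: delta_mx 0 j] r.
apply: (@bigO_eq _ _ _ _ _ _ (fun t =>
    \sum_l w l * g.[tau l] *
      (stage_error l j t * (dfj j (exact_stage l t) - G.[tau l * t.1])) +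
    \sum_(p < size G) G`_p * t.1 ^+ p * moment (g * 'X^p) j t)) => [t|].
  under [X in _ + X]eq_bigr do rewrite /moment mulr_sumr.
  rewrite exchange_big /= -big_split; apply: eq_bigr => l _ /=.
  rewrite [G.[_]]horner_coef.
  have -> : \sum_(i < size G) G`_i * t.1 ^+ i *
        (w l * (g * 'X^i).[tau l] * stage_error l j t) =
      w l * g.[tau l] * (stage_error l j t * \sum_(i < size G) G`_i * (tau l * t.1) ^+ i).
    rewrite !mulr_sumr; apply: eq_bigr => i _.
    by rewrite hornerM hornerXn exprMn; ring.
  by ring.
apply: bigOD.
  apply: bigO_sum => l _; apply: bigOZ; apply: (@bigO_leq _ _ _ _ (s.+1 + s)%N).
    by lia.
  apply: bigOM; first exact: stage_error_order.
  by apply: (bigO_pullback _ hG) => t Dt ht; exact: scaled_le.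
(* The factor h^p repays the [p] orders lost by the higher degree, also when the subtraction
   truncates to 0. *)
apply: bigO_sum => p _; apply: (@bigO_leq _ _ _ _ (p + (s.*2.+1 - (m + p)))%N).
  by lia.
apply: bigOM; first by apply: bigOZ; exact: bigO_hX.
apply: IH; first exact: leq_addr.
by rewrite (leq_trans (size_polyMleq _ _)) // size_polyXn addnS leq_add2r.
Qed.

(** Here [m] bounds the size, one more than the degree. For m >= s the stage error alone suffices;
    below that, D(s-1) replaces [g] by [G] of size at most m+1 in exchange for a factor h. *)
Lemma moment_order m (g : {poly R}) r : (size g <= m)%N ->
  O (s.*2.+1 - m) (moment g r).
Proof.
(* The descending induction on [m] runs as an ascending one on [c], under the invariant s <= m +
   c. *)
move: {2}s (leq_addl m s) => c; elim: c m g r => [|c IH] m g r hc hg.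
  rewrite addn0 in hc.
  apply: bigO_sum => l _; apply: bigOZ; apply: bigO_leq (stage_error_order l r).
  by lia.
have [sm|ms] := leqP s m.
  apply: bigO_sum => l _; apply: bigOZ; apply: bigO_leq (stage_error_order l r).
  by lia.
have hg' : (size g <= s.-1)%N by lia.
pose G := (pint g)%:P - prim g.
have hG : (size G <= m.+1)%N.
  rewrite (leq_trans (size_polyD _ _)) // size_polyN geq_max.
  by rewrite (leq_trans (size_polyC_leq1 _)) // (leq_trans (size_prim g)).
have key l : w l * G.[tau l] = \sum_i w i * g.[tau i] * A i l.
  by rewrite (hbvmA_D s_gt0 tau01 exact).
apply: (@bigO_eqD _ _ _ _ _ _ (fun t =>
    t.1 * (\sum_l w l * G.[tau l] * field_error l r t) +
    \sum_l w l * g.[tau l] * defect (A l) (tau l) r t)) => [t Dt|].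
  rewrite /moment; under eq_bigr do rewrite (stage_error_eq _ _ Dt) mulrDr.
  rewrite big_split /=; congr (_ + _).
  under [in RHS]eq_bigr do rewrite key mulr_suml.
  rewrite exchange_big mulr_sumr /=; apply: eq_bigr => l _.
  rewrite !mulr_sumr; apply: eq_bigr => j _; ring.
apply: bigOD.
  have -> : (s.*2.+1 - m = (s.*2.+1 - m.+1).+1)%N by lia.
  apply: bigO_hM; apply: df_moment_order hG _ => m' g' hm' hg'' r'.
  by apply: IH => //; lia.
have -> : (s.*2.+1 - m = (s.*2 - m).+1)%N by lia.
(* Powers p < 2s - m satisfy size g + p < 2s, the range of [hbvmA_defect]. *)
apply: defect_order => // p hp.
rewrite -[RHS](@hbvmA_defect R k s tau s_gt0 tau01 exact g p) //.
by lia.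
Qed.

(** The moment with g = 1 has size 1 and loses one order, which the factor h restores; B(2s)
    controls the defect of the final step. *)
Lemma step_error_order r :
  O s.*2.+1 (fun t => (rk_step w t.1 f (y t0) t.2 - y (t0 + t.1)) 0 r).
Proof.
apply: (@bigO_eq _ _ _ _ _ _ (fun t =>
    t.1 * (\sum_l w l * (1 : {poly R}).[tau l] * field_error l r t) +
    defect w 1 r t)) => [t|].
  rewrite /rk_step /defect !mxE summxE mul1r.
  under eq_bigr do rewrite mxE.
  under [X in _ = _ * X + _]eq_bigr do rewrite hornerC mulr1 mulrBr.
  rewrite sumrB; ring.
apply: bigOD.
  have -> : s.*2.+1 = (s.*2.+1 - 1).+1 by lia.
  apply: bigO_hM; apply: df_moment_order; first by rewrite size_poly1.
  by move=> m' g' _ hg' r'; exact: moment_order.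
have := @defect_order 'I_1 (fun=> 1) (fun=> w) (fun=> 1) s.*2.
have h01 : 0 <= (1 : R) <= 1 by rewrite ler01 lexx.
move=> /(_ (fun=> h01) _ r) H; apply: bigO_eq (H _) => [t|p ps].
  by rewrite big_ord1 mul1r.
rewrite big_ord1 mul1r.
under eq_bigr do rewrite -hornerXn.
by rewrite (quad_pint exact) ?subrr // size_polyXn.
Qed.

End LocalError.

(** * Existence of the stages *)

Section StageExistence.
Variables (R : realType) (k n : nat).

(** Supplies the completeness used by [banach_fixed_point]; the stages are stored as the rows of a
    matrix. *)
HB.instance Definition _ :=
  Uniform_isComplete.Build 'M[R]_(k, n) (@cauchy_cvg 'M[R]_(k, n)).

(** Banach's fixed point theorem on the closed ball of radius [delta] around the constant stage
    vector [y0]. *)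
Lemma rk_stages_exist (A : 'M[R]_k) (f : 'rV[R]_n -> 'rV[R]_n) (y0 : 'rV[R]_n)
    (delta L : R) : 0 < delta -> 0 <= L ->
  (forall r z z', `|z - y0| <= delta -> `|z' - y0| <= delta ->
     `|f z' 0 r - f z 0 r| <= L * `|z' - z|) ->
  exists2 h1 : R, 0 < h1 & forall h, 0 <= h <= h1 ->
    exists Y, rk_stages A h f y0 Y /\ forall i, `|Y i - y0| <= delta.
Proof.
move=> delta0 L0 f_lip.
pose K := \sum_i \sum_j `|A i j|.
have K0 : 0 <= K by apply: sumr_ge0 => i _; exact: sumr_ge0.
have KE (c : 'I_k -> R) (b : R) i : (forall j, `|c j| <= b) ->
    `|\sum_j A i j * c j| <= K * b.
  move=> cb; apply: le_trans (ler_norm_sum _ _ _) _.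
  apply: (@le_trans _ _ (\sum_j `|A i j| * b)).
    by apply: ler_sum => j _; rewrite normrM ler_wpM2l.
  rewrite -mulr_suml; have [b0|b0] := leP 0 b.
    apply: ler_wpM2r => //; rewrite /K [leRHS](bigD1 i) //= lerDl.
    by apply: sumr_ge0 => i' _; exact: sumr_ge0.
  by have := le_trans (normr_ge0 _) (cb i); rewrite leNgt b0.
pose B := `|f y0| + L * delta.
have B0 : 0 <= B by rewrite addr_ge0 // mulr_ge0 // ltW.
(* [B] bounds the entries of [f] on the ball. The first cap makes the map preserve the ball, the
   second makes it contract by 1/2. *)
exists (Num.min (delta / (K * B + 1)) (2 * (K * L + 1))^-1).
  by rewrite lt_min divr_gt0 ?invr_gt0 //=; nra.
move=> h; rewrite le_min => /andP[h0 /andP[hB hL]].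
pose M0 : 'M[R]_(k, n) := \matrix_(i, r) y0 0 r.
pose Phi (M : 'M[R]_(k, n)) : 'M[R]_(k, n) :=
  \matrix_(i, r) (y0 0 r + h * \sum_j A i j * f (row j M) 0 r).
pose U := closed_ball M0 delta.
have inU M : U M -> forall i, `|row i M - y0| <= delta.
  rewrite /U closed_ballE // => /= hM i; rewrite distrC.
  have -> : y0 - row i M = row i (M0 - M) by apply/rowP => r; rewrite !mxE.
  exact: le_trans (row_matrix_norm _ _) hM.
have hKB : h * (K * B) <= delta.
  have : h * (K * B + 1) <= delta by rewrite -ler_pdivlMr //; nra.
  by nra.
have hKL : h * (K * L) <= 2^-1.
  have : h * (2 * (K * L + 1)) <= 1 by rewrite -ler_pdivlMr ?mul1r //; nra.
  by nra.
have PhiU M : U M -> U (Phi M).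
  move=> UM; rewrite /U closed_ballE //=; apply: matrix_norm_le => [|i r].
    exact: ltW.
  rewrite !mxE opprD addrA subrr sub0r normrN normrM ger0_norm //.
  apply: le_trans hKB; apply: ler_wpM2l => //; apply: KE => j.
  rewrite -(subrK (f y0 0 r) (f _ 0 r)) addrC.
  apply: le_trans (ler_normD _ _) _; apply: lerD; first exact: matrix_entry_norm.
  apply: le_trans (f_lip _ _ _ _ (inU _ UM j)) _; first by rewrite subrr normr0 ltW.
  by apply: ler_wpM2l => //; exact: inU.
have ctr : is_contraction (mkfun PhiU).
  have q0 : 0 <= 2^-1 :> R by lra.
  exists (NngNum q0); split; first by rewrite /= invf_lt1 ?ltr1n.
  move=> [M M'] /= [UM UM']; apply: matrix_norm_le => [|i r].
    by rewrite mulr_ge0.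
  rewrite !mxE opprD addrACA subrr add0r -mulrBr -sumrB.
  under eq_bigr do rewrite -mulrBr.
  rewrite normrM ger0_norm //.
  apply: (@le_trans _ _ (h * (K * (L * `|M - M'|)))).
    apply: ler_wpM2l => //; apply: KE => j.
    apply: le_trans (f_lip _ _ _ (inU _ UM' j) (inU _ UM j)) _.
    apply: ler_wpM2l => //; rewrite -linearB /=; exact: row_matrix_norm.
  by rewrite mulrA mulrA -[h * K * L]mulrA; apply: ler_wpM2r.
have [] := banach_fixed_point ctr (@closed_ball_closed _ _ _ _).
  by exists M0; rewrite /U closed_ballE // /closed_ball_ /= subrr normr0 ltW.
move=> M UM /= fixM; exists (fun i => row i M); split; last exact: inU.
move=> i; apply/rowP => r; rewrite mxE {1}fixM !mxE summxE.
by congr (_ + _ * _); apply: eq_bigr => j _; rewrite mxE.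
Qed.

End StageExistence.

(** * Assembly of stage existence and local error *)

Theorem theorem1p1 (R : realType) (k s : nat) (tau : 'I_k -> R) :
  (1 <= s)%N -> (s <= k)%N ->
  injective tau ->
  (forall i, 0 <= tau i <= 1) ->
  quad_exact_upto tau s.*2 ->
  rk_has_order (hbvmA s tau) (hbvmb tau) s.*2.
Proof.
move=> s_gt0 _ _ tau01 exact m f f_smooth t0 y0 a y a0 <- y_sol.
have [L [rho1 [L0 rho10 HL]]] :=
  iderive_lipschitz f_smooth (fun _ : unit => [::]) (y t0).
have [C [rho2 [C0 rho20 HC]]] := iderive_linearization f_smooth [::] (y t0).
(* One radius has to serve both the Lipschitz bound and the linearization. *)
pose delta := Num.min rho1 rho2.
have delta0 : 0 < delta by rewrite lt_min rho10.
have f_lip r z z' : `|z - y t0| <= delta -> `|z' - y t0| <= delta ->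
    `|f z' 0 r - f z 0 r| <= L * `|z' - z|.
  rewrite !le_min => /andP[hz _] /andP[hz' _].
  by have := HL tt r z z' hz hz' _ (leqnn _); rewrite mixn.
have f_lin r z z' : `|z - y t0| <= delta -> `|z' - y t0| <= delta ->
  `|f z' 0 r - f z 0 r -
    \sum_j (z' 0 j - z 0 j) * iderive [:: delta_mx 0 j] f z 0 r|
     <= C * `|z' - z| ^+ 2.
  by rewrite !le_min => /andP[_ hz] /andP[_ hz']; exact: HC.
have [h1 h10 Hex] := rk_stages_exist (hbvmA s tau) delta0 L0 f_lip.
(* Summing the entrywise estimates gives one constant that bounds the norm of the whole error
   vector. *)
have := @bigO_sum R _ _ _ s.*2.+1 _ (index_enum _) xpredT _ (fun r _ =>
  bigO_norm (step_error_order s_gt0 tau01 exact f_smooth a0 y_sol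
    delta0 L0 C0 f_lip f_lin r)).
move=> [C' [h2 [C'0 h20 Herr]]].
exists delta, C', (Num.min (Num.min h1 h2) (a / 2)); split => //.
- by rewrite !lt_min h10 h20 divr_gt0.
- by rewrite gt_min; apply/orP; right; rewrite ltr_pdivrMr // ltr_pMr // ltr1n.
move=> h /andP[h0]; rewrite !le_min => /andP[/andP[hh1 hh2] _]; split.
  by apply: Hex; rewrite ltW.
move=> Y HY Yd; apply: le_trans (row_norm_sum _) _.
have := Herr (h, Y) (conj HY Yd); rewrite /= ltW //= => /(_ hh2).
by apply: le_trans; exact: ler_norm.
Qed.
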